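(* Let $P\in\mathcal B\setminus\mathcal B_0$. There exist a neighbourhood $\mathcal U$ of $P$ and constants $D_1,D_2>0$ (depending on $P$ and the initial data) such that for all $(u,v)\in\mathcal T\cap\mathcal U$, $$|\partial_u\phi(u,v)|\le\frac{D_1}{r(u,v)^2},\qquad|\partial_v\phi(u,v)|\le\frac{D_2}{r(u,v)^2}.$$
   Context: Consider the Einstein–scalar field system $\mathrm{Ric}_{\mu\nu}-\frac12Rg_{\mu\nu}=2T_{\mu\nu}$, $T_{\mu\nu}=\partial_\mu\phi\,\partial_\nu\phi-\frac12 g_{\mu\nu}\partial^\sigma\phi\,\partial_\sigma\phi$, under spherical symmetry in double null coordinates, $g=-\Omega^2(u,v)\,du\,dv+r^2(u,v)(d\theta^2+\sin^2\theta\,d\varphi^2)$. The system is then equivalent to $r\partial_u\partial_v r=-\partial_ur\,\partial_vr-\frac14\Omega^2$, $r^2\partial_u\partial_v\log\Omega=\partial_ur\,\partial_vr+\frac14\Omega^2-r^2\partial_u\phi\,\partial_v\phi$, $r\partial_u\partial_v\phi=-\partial_ur\,\partial_v\phi-\partial_vr\,\partial_u\phi$, $\partial_u(\Omega^{-2}\partial_ur)=-r\Omega^{-2}(\partial_u\phi)^2$, $\partial_v(\Omega^{-2}\partial_vr)=-r\Omega^{-2}(\partial_v\phi)^2$. We consider the maximal future development of Christodoulou's spherically symmetric characteristic initial data (prescribed on an outgoing null cone $u=u_0$ and an incoming null cone $v=v_1$, with regular centre $\Gamma$) in which a trapped surface has formed. The trapped region is $\mathcal T=\{\partial_vr<0,\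 \partial_ur<0,\ r>0\}$; its past boundary is the apparent horizon $\mathcal A=\{\partial_v r=0\}$. The future boundary $\mathcal B$ is singular with $r=0$ on $\mathcal B$; $\mathcal B_0$ is the first singular point on the centre, and $\mathcal B\setminus\mathcal B_0$ is a spacelike $C^1$ curve. *)

(* Defs.v *)
From Stdlib Require Import Reals Lra.
Open Scope R_scope.

Definition pd_u (f : R -> R -> R) (u v l : R) : Prop :=
  derivable_pt_lim (fun x => f x v) u l.
Definition pd_v (f : R -> R -> R) (u v l : R) : Prop :=
  derivable_pt_lim (fun y => f u y) v l.

Definition cont2_at (S : R -> R -> Prop) (f : R -> R -> R) (u v : R) : Prop :=
  forall eps, 0 < eps -> exists delta, 0 < delta /\
    forall x y, S x y -> Rabs (x - u) < delta -> Rabs (y - v) < delta ->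
      Rabs (f x y - f u v) < eps.

(** Characteristic initial data: values of (r, Omega, phi) on the outgoing
    cone {u = u0, v >= v1} and on the incoming cone {v = v1, u0 <= u <= v1},
    the latter ending at the centre point (v1,v1). The centre is {u = v}. *)
Record CharData := {
  cd_u0 : R; cd_v1 : R;
  r_out : R -> R; Om_out : R -> R; phi_out : R -> R;
  r_in : R -> R; Om_in : R -> R; phi_in : R -> R }.

Record Sol := {
  sr : R -> R -> R; sOm : R -> R -> R; sphi : R -> R -> R;
  sru : R -> R -> R; srv : R -> R -> R;
  sOmu : R -> R -> R; sOmv : R -> R -> R;
  sphiu : R -> R -> R; sphiv : R -> R -> R }.

Definition Reg (d : CharData) (u v : R) : Prop :=
  cd_u0 d <= u /\ u <= v /\ cd_v1 d <= v.
Definition Int (d : CharData) (u v : R) : Prop :=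
  cd_u0 d < u /\ u < v /\ cd_v1 d < v.

(** (Q, s) is a (future) development of the data d solving the spherically
    symmetric Einstein-scalar field system in double null gauge. *)
Definition IsDevelopment (d : CharData) (Q : R -> R -> Prop) (s : Sol) : Prop :=
  let r := sr s in let Om := sOm s in let phi := sphi s in
  let ru := sru s in let rv := srv s in let Omu := sOmu s in let Omv := sOmv s in
  let phiu := sphiu s in let phiv := sphiv s in
  let QI := fun u v => Q u v /\ Int d u v in
  cd_u0 d < cd_v1 d /\
  (forall u v, Q u v -> Reg d u v) /\
  (forall v, cd_v1 d <= v -> Q (cd_u0 d) v) /\
  (forall u, cd_u0 d <= u <= cd_v1 d -> Q u (cd_v1 d)) /\
  (forall u v u' v', Q u v -> Reg d u' v' -> u' <= u -> v' <= v -> Q u' v') /\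
  (forall u v, Q u v -> exists delta, 0 < delta /\
     forall x y, Reg d x y -> Rabs (x - u) < delta -> Rabs (y - v) < delta -> Q x y) /\
  (forall u v, Q u v -> cont2_at Q r u v /\ cont2_at Q Om u v /\ cont2_at Q phi u v) /\
  (forall u v, QI u v ->
     pd_u r u v (ru u v) /\ pd_v r u v (rv u v) /\
     pd_u Om u v (Omu u v) /\ pd_v Om u v (Omv u v) /\
     pd_u phi u v (phiu u v) /\ pd_v phi u v (phiv u v) /\
     cont2_at QI ru u v /\ cont2_at QI rv u v /\ cont2_at QI Omu u v /\
     cont2_at QI Omv u v /\ cont2_at QI phiu u v /\ cont2_at QI phiv u v) /\
  (forall u v, QI u v ->
     (exists a, pd_v ru u v a /\
        r u v * a = - ru u v * rv u v - / 4 * Om u v ^ 2) /\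
     (exists b, pd_v (fun x y => Omu x y / Om x y) u v b /\
        r u v ^ 2 * b = ru u v * rv u v + / 4 * Om u v ^ 2
                        - r u v ^ 2 * phiu u v * phiv u v) /\
     (exists c, pd_v phiu u v c /\
        r u v * c = - ru u v * phiv u v - rv u v * phiu u v) /\
     pd_u (fun x y => ru x y / Om x y ^ 2) u v
          (- r u v / Om u v ^ 2 * phiu u v ^ 2) /\
     pd_v (fun x y => rv x y / Om x y ^ 2) u v
          (- r u v / Om u v ^ 2 * phiv u v ^ 2)) /\
  (forall u v, Q u v -> 0 < Om u v) /\
  (forall u v, Q u v -> u < v -> 0 < r u v) /\
  (forall u, Q u u -> r u u = 0) /\
  (forall v, cd_v1 d <= v ->
     r (cd_u0 d) v = r_out d v /\ Om (cd_u0 d) v = Om_out d v /\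
     phi (cd_u0 d) v = phi_out d v) /\
  (forall u, cd_u0 d <= u <= cd_v1 d ->
     r u (cd_v1 d) = r_in d u /\ Om u (cd_v1 d) = Om_in d u /\
     phi u (cd_v1 d) = phi_in d u).

Definition IsMaxDevelopment (d : CharData) (Q : R -> R -> Prop) (s : Sol) : Prop :=
  IsDevelopment d Q s /\
  forall Q' s', IsDevelopment d Q' s' ->
    forall u v, Q' u v ->
      Q u v /\ sr s' u v = sr s u v /\ sOm s' u v = sOm s u v /\
      sphi s' u v = sphi s u v.

Definition Trapped (d : CharData) (Q : R -> R -> Prop) (s : Sol) (u v : R) : Prop :=
  Q u v /\ Int d u v /\ srv s u v < 0 /\ sru s u v < 0 /\ 0 < sr s u v.

Definition FutBdry (Q : R -> R -> Prop) (u v : R) : Prop :=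
  ~ Q u v /\ forall delta, 0 < delta ->
    exists x y, Q x y /\ Rabs (x - u) < delta /\ Rabs (y - v) < delta.

(** Structure of B assumed in the paper: B_0 = (b,b) is the first singular
    point on the centre; r = 0 on B (r extends continuously by 0);
    B \ B_0 is a spacelike C^1 curve, i.e. locally near each of its points
    the graph v = beta(u) of a C^1 function with beta' < 0, with Q lying
    to its past. *)
Definition SingularBoundary (d : CharData) (Q : R -> R -> Prop) (s : Sol) (b : R) : Prop :=
  FutBdry Q b b /\
  (forall u, cd_v1 d <= u < b -> Q u u) /\
  (forall u v, FutBdry Q u v ->
     forall eps, 0 < eps -> exists delta, 0 < delta /\
       forall x y, Q x y -> Rabs (x - u) < delta -> Rabs (y - v) < delta ->
         Rabs (sr s x y) < eps) /\
  (forall u v, FutBdry Q u v -> (u, v) <> (b, b) ->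
     exists delta beta beta', 0 < delta /\ beta u = v /\
       (forall x, Rabs (x - u) < delta ->
          derivable_pt_lim beta x (beta' x) /\ continuity_pt beta' x /\ beta' x < 0) /\
       (forall x y, Rabs (x - u) < delta -> Rabs (y - v) < delta ->
          (FutBdry Q x y <-> y = beta x) /\ (Q x y <-> y < beta x))).

(* Main.v *)
Require Import Defs.
From Stdlib Require Import Reals Lra Classical.
Open Scope R_scope.

(** Near [P] the past of a trapped point, cut off at a rectangle corner, is trapped. There the
    quantities [W = r phi_u / r_u] and [Z = r phi_v / r_v] solve
      [d_v W = (|r_v| / r) (Z - W) - k W],  [d_u Z = (|r_u| / r) (W - Z) - k' Z],
    with [k = Omega^2 / (4 r |r_u|) > 0] and [k' = Omega^2 / (4 r |r_v|) > 0], so [max (|W|, |Z|)]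
    over a past rectangle is attained on its two initial edges. Since [r |r_u|] and [r |r_v|] are
    bounded (Raychaudhuri gives [Omega^2 <= K |r_v|], whence [d_v (r |r_u|) = Omega^2 / 4] is at
    most [- K/4 d_v r]), the bounds on [W] and [Z] are the inverse square bounds on [phi_u] and
    [phi_v]. *)

(** * Compactness and continuity on the plane *)

(** Compactness of a segment without covers: [P s t] stands for a property of the piece from [s] to
    [t] that survives concatenation. The supremum of the points reachable from [a] can be passed
    unless it is [b]. *)
Lemma segment_local_to_global (P : R -> R -> Prop) (a b : R) :
  a <= b ->
  (forall x y z, P x y -> P y z -> P x z) ->
  (forall x, a <= x <= b -> exists delta, 0 < delta /\
     forall s t, a <= s <= t -> t <= b -> x - delta < s -> t < x + delta -> P s t) ->
  P a b.
Proof.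
  intros Hab Htr Hloc.
  set (E := fun t => a <= t <= b /\ P a t).
  assert (Ea : E a).
  { split; [lra|]. destruct (Hloc a) as [dl [Hdl H]]; [lra|]. apply H; lra. }
  destruct (completeness E) as [m [Hub Hlub]].
  - exists b. intros t [Ht _]. lra.
  - now exists a.
  - assert (Hm : a <= m <= b).
    { split; [now apply Hub|]. apply Hlub. intros t [Ht _]. lra. }
    destruct (Hloc m Hm) as [dl [Hdl H]].
    assert (Hex : exists t, E t /\ m - dl < t).
    { apply NNPP. intros Hn. assert (m <= m - dl); [|lra].
      apply Hlub. intros t Et. apply Rnot_lt_le. intros Hlt. apply Hn. now exists t. }
    destruct Hex as [t [[Ht Pt] Hmt]].
    assert (t <= m) by (apply Hub; split; assumption).
    (* [t'] lies beyond the supremum [m] unless it has been stopped at [b]; as [P a t'] holds, only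
       [t' = b] remains. *)
    set (t' := Rmin b (m + dl / 2)).
    assert (Ht' : m <= t' <= b /\ t' <= m + dl / 2 /\ (t' = b \/ t' = m + dl / 2)).
    { unfold t', Rmin. destruct (Rle_dec b (m + dl / 2)); lra. }
    assert (Pt' : P a t').
    { apply (Htr a t t'); [assumption|]. apply H; lra. }
    assert (t' <= m) by (apply Hub; split; [lra|assumption]).
    destruct Ht' as [? [? [Heq|Heq]]]; [now rewrite Heq in Pt'|lra].
Qed.

(** If no maximum existed, each point would be strictly beaten by some value of [F], which by
    continuity beats a whole neighbourhood. Being dominated by a single value passes to finite
    unions, so by compactness one value would dominate the rectangle after all. *)
Lemma rectangle_max (D : R -> R -> Prop) (F : R -> R -> R) (a b c d : R) :
  a <= b -> c <= d ->
  (forall x y, a <= x <= b -> c <= y <= d -> D x y /\ cont2_at D F x y) ->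
  exists p q, a <= p <= b /\ c <= q <= d /\
    forall x y, a <= x <= b -> c <= y <= d -> F x y <= F p q.
Proof.
  intros Hab Hcd HF. apply NNPP. intros Hno.
  set (dom := fun S : R -> R -> Prop => exists p q, a <= p <= b /\ c <= q <= d /\
    forall x y, a <= x <= b -> c <= y <= d -> S x y -> F x y <= F p q).
  assert (dom_union : forall S1 S2 S : R -> R -> Prop, dom S1 -> dom S2 ->
            (forall x y, S x y -> S1 x y \/ S2 x y) -> dom S).
  { intros S1 S2 S [p1 [q1 [Hp1 [Hq1 H1]]]] [p2 [q2 [Hp2 [Hq2 H2]]]] HS.
    destruct (Rle_dec (F p1 q1) (F p2 q2)) as [Hle|Hle].
    - exists p2, q2. do 2 (split; [assumption|]). intros x y Hx Hy Sxy.
      destruct (HS x y Sxy) as [Sx|Sx]; [specialize (H1 x y Hx Hy Sx); lra|now apply H2].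
    - exists p1, q1. do 2 (split; [assumption|]). intros x y Hx Hy Sxy.
      destruct (HS x y Sxy) as [Sx|Sx]; [now apply H1|specialize (H2 x y Hx Hy Sx); lra]. }
  assert (dom_local : forall x y, a <= x <= b -> c <= y <= d ->
            exists delta, 0 < delta /\
              dom (fun x' y' => Rabs (x' - x) < delta /\ Rabs (y' - y) < delta)).
  { intros x y Hx Hy.
    assert (Hlt : exists p q, a <= p <= b /\ c <= q <= d /\ F x y < F p q).
    { apply NNPP. intros Hn. apply Hno. exists x, y. do 2 (split; [assumption|]).
      intros p q Hp Hq. apply Rnot_lt_le. intros Hlt. apply Hn. now exists p, q. }
    destruct Hlt as [p [q [Hp [Hq Hlt]]]].
    destruct (HF x y Hx Hy) as [_ HC].
    destruct (HC (F p q - F x y)) as [dl [Hdl H]]; [lra|].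
    exists dl. split; [assumption|]. exists p, q. do 2 (split; [assumption|]).
    intros x' y' Hx' Hy' [Hdx Hdy].
    specialize (H x' y' (proj1 (HF x' y' Hx' Hy')) Hdx Hdy).
    apply Rabs_def2 in H. lra. }
  assert (dom_all : dom (fun x y => a <= x <= b)).
  { apply (segment_local_to_global (fun s t => dom (fun x _ => s <= x <= t))); [assumption| |].
    { intros s m t H1 H2. apply (dom_union _ _ _ H1 H2). intros x _ Hx.
      destruct (Rle_dec x m); lra. }
    intros x Hx.
    (* Compactness is used twice: first along the vertical segment over [x], giving a thin dominated
       strip, then along the horizontal side, gluing strips. *)
    assert (Hstrip : exists delta, 0 < delta /\
              dom (fun x' y' => Rabs (x' - x) < delta /\ c <= y' <= d)).
    { apply (segment_local_to_global (fun s t => exists delta, 0 < delta /\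
              dom (fun x' y' => Rabs (x' - x) < delta /\ s <= y' <= t))); [assumption| |].
      { intros s m t [d1 [Hd1 H1]] [d2 [Hd2 H2]]. exists (Rmin d1 d2).
        split; [now apply Rmin_pos|]. apply (dom_union _ _ _ H1 H2). intros x' y' [Hx' Hy'].
        pose proof (Rmin_l d1 d2). pose proof (Rmin_r d1 d2).
        destruct (Rle_dec y' m); [left|right]; lra. }
      intros y Hy. destruct (dom_local x y Hx Hy) as [dl [Hdl H]].
      exists dl. split; [assumption|]. intros s t Hs Ht Hsd Htd.
      exists dl. split; [assumption|]. apply (dom_union _ _ _ H H).
      intros x' y' [Hx' Hy']. left. split; [assumption|]. apply Rabs_def1; lra. }
    destruct Hstrip as [dl [Hdl H]]. exists dl. split; [assumption|].
    intros s t Hs Ht Hsd Htd. destruct H as [p [q [Hp [Hq H]]]].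
    exists p, q. do 2 (split; [assumption|]). intros x' y' Hx' Hy' Hx''.
    apply H; [assumption|assumption|]. split; [apply Rabs_def1; lra|assumption]. }
  destruct dom_all as [p [q [Hp [Hq H]]]]. apply Hno. exists p, q.
  do 2 (split; [assumption|]). intros x y Hx Hy. now apply H.
Qed.

(** * Rules for continuity in two variables *)

Lemma cont2_at_subset (S S' : R -> R -> Prop) (f : R -> R -> R) (u v : R) :
  (forall x y, S' x y -> S x y) -> cont2_at S f u v -> cont2_at S' f u v.
Proof.
  intros HS H eps Heps. destruct (H eps Heps) as [dl [Hdl H']].
  exists dl. split; [assumption|]. intros x y Sxy. apply H', HS, Sxy.
Qed.

Lemma cont2_at_swap (S : R -> R -> Prop) (f : R -> R -> R) (u v : R) :
  cont2_at S f u v -> cont2_at (fun x y => S y x) (fun x y => f y x) v u.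
Proof.
  intros H eps Heps. destruct (H eps Heps) as [dl [Hdl H']].
  exists dl. split; [assumption|]. intros x y Sxy Hx Hy. now apply H'.
Qed.

Lemma cont2_at_const (S : R -> R -> Prop) (k u v : R) : cont2_at S (fun _ _ => k) u v.
Proof.
  intros eps Heps. exists 1. split; [lra|]. intros x y _ _ _.
  now rewrite Rminus_diag, Rabs_R0.
Qed.

Lemma cont2_at_continuity_pt (h : R -> R) (S : R -> R -> Prop) (f : R -> R -> R) (u v : R) :
  continuity_pt h (f u v) -> cont2_at S f u v -> cont2_at S (fun x y => h (f x y)) u v.
Proof.
  intros Hh Hf eps Heps. destruct (Hh eps Heps) as [e [He H]].
  destruct (Hf e He) as [dl [Hdl H1]].
  exists dl. split; [assumption|]. intros x y Sxy Hx Hy.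
  (* [continuity_pt] speaks only of arguments different from the base point, so equal values are
     treated apart. *)
  destruct (Req_dec (f u v) (f x y)) as [Heq|Hne].
  - now rewrite Heq, Rminus_diag, Rabs_R0.
  - apply H. split; [now split|]. now apply H1.
Qed.

Lemma cont2_at_plus (S : R -> R -> Prop) (f g : R -> R -> R) (u v : R) :
  cont2_at S f u v -> cont2_at S g u v -> cont2_at S (fun x y => f x y + g x y) u v.
Proof.
  intros Hf Hg eps Heps.
  destruct (Hf (eps / 2)) as [d1 [Hd1 H1]]; [lra|].
  destruct (Hg (eps / 2)) as [d2 [Hd2 H2]]; [lra|].
  exists (Rmin d1 d2). split; [now apply Rmin_pos|]. intros x y Sxy Hx Hy.
  pose proof (Rmin_l d1 d2). pose proof (Rmin_r d1 d2).
  assert (E1 : Rabs (f x y - f u v) < eps / 2) by (apply H1; (assumption || lra)).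
  assert (E2 : Rabs (g x y - g u v) < eps / 2) by (apply H2; (assumption || lra)).
  apply Rabs_def2 in E1, E2. apply Rabs_def1; lra.
Qed.

(* Polarization reduces products to sums and squares. *)
Lemma cont2_at_mult (S : R -> R -> Prop) (f g : R -> R -> R) (u v : R) :
  cont2_at S f u v -> cont2_at S g u v -> cont2_at S (fun x y => f x y * g x y) u v.
Proof.
  intros Hf Hg.
  assert (Hc : forall k h, cont2_at S h u v -> cont2_at S (fun x y => k * h x y) u v).
  { intros k h Hh. apply (cont2_at_continuity_pt (fun t => k * t)); [reg|assumption]. }
  assert (Hs : forall h, cont2_at S h u v -> cont2_at S (fun x y => h x y ^ 2) u v).
  { intros h Hh. apply (cont2_at_continuity_pt (fun t => t ^ 2)); [reg|assumption]. }
  assert (H : cont2_at S (fun x y => / 4 * (f x y + g x y) ^ 2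
                                      + - / 4 * (f x y + (-1) * g x y) ^ 2) u v).
  { apply cont2_at_plus; apply Hc, Hs, cont2_at_plus; try apply Hc; assumption. }
  intros eps Heps. destruct (H eps Heps) as [dl [Hdl H']].
  exists dl. split; [assumption|]. intros x y Sxy Hx Hy. specialize (H' x y Sxy Hx Hy).
  match goal with |- Rabs ?e < _ => match type of H' with Rabs ?e' < _ =>
    replace e with e' by field end end. assumption.
Qed.

Lemma cont2_at_div (S : R -> R -> Prop) (f g : R -> R -> R) (u v : R) :
  g u v <> 0 -> cont2_at S f u v -> cont2_at S g u v ->
  cont2_at S (fun x y => f x y / g x y) u v.
Proof.
  intros H0 Hf Hg. apply cont2_at_mult; [assumption|].
  apply (cont2_at_continuity_pt Rinv); [|assumption].
  apply (continuity_pt_inv id); [reg|assumption].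
Qed.

Lemma cont2_at_opp (S : R -> R -> Prop) (f : R -> R -> R) (u v : R) :
  cont2_at S f u v -> cont2_at S (fun x y => - f x y) u v.
Proof. apply (cont2_at_continuity_pt Ropp). reg. Qed.

Lemma cont2_at_pow (S : R -> R -> Prop) (f : R -> R -> R) (n : nat) (u v : R) :
  cont2_at S f u v -> cont2_at S (fun x y => f x y ^ n) u v.
Proof. apply (cont2_at_continuity_pt (fun t => t ^ n)). reg. Qed.

(** * Mean values, mixed partials and signs of derivatives *)

Lemma mean_value_signed (g g' : R -> R) (a l : R) :
  l <> 0 ->
  (forall x, Rabs (x - a) <= Rabs l -> derivable_pt_lim g x (g' x)) ->
  exists c, g (a + l) - g a = g' c * l /\ Rabs (c - a) <= Rabs l.
Proof.
  intros Hl Hg. destruct (Rlt_dec 0 l) as [Hp|Hp].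
  - destruct (MVT_cor2 g g' a (a + l)) as [c [Hc1 Hc2]]; [lra| |].
    + intros x Hx. apply Hg. rewrite !Rabs_pos_eq; lra.
    + exists c. split; [rewrite Hc1; ring|rewrite !Rabs_pos_eq; lra].
  - destruct (MVT_cor2 g g' (a + l) a) as [c [Hc1 Hc2]]; [lra| |].
    + intros x Hx. apply Hg. rewrite !Rabs_left1; lra.
    + exists c. split; [|rewrite !Rabs_left1; lra].
      replace (g' c * l) with (- (g' c * (a - (a + l)))) by ring. rewrite <- Hc1. ring.
Qed.

(* Schwarz's theorem in Peano's form: [f_vu] exists and is continuous near the point, while the
   existence of [f_uv] is a conclusion. The second difference of [f] equals [h * k * fuv] at an
   intermediate point; dividing by [k] and letting [k] tend to 0 gives the difference quotient of [fv]. *)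
Lemma mixed_partials (D : R -> R -> Prop) (f fu fv fuv : R -> R -> R) (u v : R) :
  (exists delta, 0 < delta /\ forall x y, Rabs (x - u) < delta -> Rabs (y - v) < delta -> D x y) ->
  (forall x y, D x y -> pd_u f x y (fu x y) /\ pd_v f x y (fv x y) /\ pd_v fu x y (fuv x y)) ->
  cont2_at D fuv u v ->
  pd_u fv u v (fuv u v).
Proof.
  intros [d0 [Hd0 Hnb]] Hf Hc eps Heps.
  destruct (Hc (eps / 2)) as [d1 [Hd1 H1]]; [lra|].
  assert (Hdm : 0 < Rmin d0 d1) by now apply Rmin_pos.
  pose proof (Rmin_l d0 d1). pose proof (Rmin_r d0 d1).
  exists (mkposreal _ Hdm). simpl. intros h Hh0 Hh.
  assert (Hdiff : forall k, k <> 0 -> Rabs k < Rmin d0 d1 ->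
    Rabs ((f (u + h) (v + k) - f (u + h) v) / k - (f u (v + k) - f u v) / k
           - h * fuv u v) <= Rabs h * (eps / 2)).
  { intros k Hk0 Hk.
    assert (HD : forall x y, Rabs (x - u) <= Rabs h -> Rabs (y - v) <= Rabs k ->
              D x y /\ Rabs (fuv x y - fuv u v) < eps / 2).
    { intros x y Hx Hy. assert (D x y) by (apply Hnb; lra).
      split; [assumption|]. apply H1; (assumption || lra). }
    (* The mean value theorem in the first variable turns the second difference into a difference of
       [fu]; a second application, in the other variable, turns that into [fuv]. *)
    destruct (mean_value_signed (fun x => f x (v + k) - f x v) (fun x => fu x (v + k) - fu x v) u h)
      as [x [Hx1 Hx2]]; [assumption| |].
    { intros x Hx.
      apply derivable_pt_lim_minus; apply Hf, HD; try assumption.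
      - replace (v + k - v) with k by ring. lra.
      - rewrite Rminus_diag, Rabs_R0. apply Rabs_pos. }
    destruct (mean_value_signed (fun y => fu x y) (fun y => fuv x y) v k) as [y [Hy1 Hy2]]; [assumption| |].
    { intros y Hy. apply Hf, HD; assumption. }
    destruct (HD x y Hx2 Hy2) as [_ Hxy].
    replace (_ / k - _ / k - _) with (h * (fuv x y - fuv u v)).
    - rewrite Rabs_mult. apply Rmult_le_compat_l; [apply Rabs_pos|lra].
    - replace ((f (u + h) (v + k) - f (u + h) v) / k - (f u (v + k) - f u v) / k)
        with ((f (u + h) (v + k) - f (u + h) v - (f u (v + k) - f u v)) / k) by (field; assumption).
      cbv beta in Hx1, Hy1. rewrite Hx1, Hy1. field. assumption. }
  assert (Huh : D (u + h) v).
  { apply Hnb; [replace (u + h - u) with h by ring; lra|].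
    rewrite Rminus_diag, Rabs_R0. assumption. }
  assert (Huv : D u v) by (apply Hnb; rewrite Rminus_diag, Rabs_R0; assumption).
  (* The limit of small [k] in [Hdiff]: a non-strict bound survives it, and [eps / 2] leaves room
     for the strict inequality required at the end. *)
  assert (Hle : Rabs (fv (u + h) v - fv u v - h * fuv u v) <= Rabs h * (eps / 2)).
  { apply le_epsilon. intros e He.
    destruct (Hf _ _ Huh) as [_ [Ha _]]. destruct (Hf _ _ Huv) as [_ [Hb _]].
    destruct (Ha (e / 2)) as [[da Hda] Ha']; [lra|].
    destruct (Hb (e / 2)) as [[db Hdb] Hb']; [lra|]. simpl in Ha', Hb'.
    set (k := Rmin (Rmin da db) (Rmin d0 d1) / 2).
    assert (Hk : 0 < k /\ k < da /\ k < db /\ k < Rmin d0 d1).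
    { pose proof (Rmin_pos _ _ (Rmin_pos _ _ Hda Hdb) Hdm).
      pose proof (Rmin_l (Rmin da db) (Rmin d0 d1)). pose proof (Rmin_r (Rmin da db) (Rmin d0 d1)).
      pose proof (Rmin_l da db). pose proof (Rmin_r da db). unfold k. lra. }
    assert (Hka : Rabs k = k) by (apply Rabs_pos_eq; lra).
    specialize (Ha' k ltac:(lra) ltac:(lra)). specialize (Hb' k ltac:(lra) ltac:(lra)).
    specialize (Hdiff k ltac:(lra) ltac:(lra)).
    apply Rabs_def2 in Ha', Hb'. apply Rabs_le.
    revert Hdiff. unfold Rabs at 1. destruct Rcase_abs; lra. }
  replace (_ / h - _) with ((fv (u + h) v - fv u v - h * fuv u v) / h) by (field; assumption).
  assert (0 < Rabs h) by now apply Rabs_pos_lt.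
  unfold Rdiv. rewrite Rabs_mult, Rabs_inv.
  apply Rmult_lt_reg_r with (Rabs h); [assumption|].
  rewrite Rmult_assoc, Rinv_l, Rmult_1_r by lra.
  apply Rle_lt_trans with (1 := Hle). rewrite Rmult_comm. apply Rmult_lt_compat_r; lra.
Qed.

Lemma nonincreasing_of_derive_nonpos (g g' : R -> R) (a b : R) :
  a <= b ->
  (forall t, a <= t <= b -> derivable_pt_lim g t (g' t) /\ g' t <= 0) ->
  g b <= g a.
Proof.
  intros Hab Hg. destruct (Req_dec a b) as [->|Hne]; [lra|].
  destruct (MVT_cor2 g g' a b) as [c [Hc Hcab]]; [lra|intros; now apply Hg|].
  assert (g' c <= 0) by (apply Hg; lra). nra.
Qed.

(** Difference quotients taken from the left of the maximum are nonnegative. The one-sided form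
    matters because the maximum over a past rectangle may sit on its future edge. *)
Lemma derive_left_max_nonneg (g : R -> R) (a t l : R) :
  a < t -> derivable_pt_lim g t l -> (forall s, a <= s <= t -> g s <= g t) -> 0 <= l.
Proof.
  intros Hat Hg Hmax. apply Rnot_lt_le. intros Hl.
  destruct (Hg (- l)) as [[dl Hdl] H]; [lra|]. simpl in H.
  set (k := Rmin (dl / 2) (t - a)).
  assert (Hk : 0 < k /\ k < dl /\ k <= t - a).
  { pose proof (Rmin_l (dl / 2) (t - a)). pose proof (Rmin_r (dl / 2) (t - a)).
    assert (0 < k) by (apply Rmin_pos; lra). fold k in H0, H1. lra. }
  specialize (H (- k) ltac:(lra)). rewrite Rabs_Ropp, Rabs_pos_eq in H by lra.
  specialize (H ltac:(lra)). apply Rabs_def2 in H.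
  specialize (Hmax (t + - k) ltac:(lra)).
  assert (0 <= (g (t + - k) - g t) / - k); [|lra].
  replace ((g (t + - k) - g t) / - k) with ((g t - g (t + - k)) / k) by (field; lra).
  apply Rle_mult_inv_pos; lra.
Qed.

(** * The field equations on a trapped rectangle *)

(* The field equations in a form symmetric in [u] and [v]: unlike in [IsDevelopment], the mixed
   derivatives exist in both orders. *)
Record RegularSolution (D : R -> R -> Prop) (r Om ru rv phiu phiv : R -> R -> R) : Prop := {
  rs_r_pos : forall u v, D u v -> 0 < r u v;
  rs_Om_pos : forall u v, D u v -> 0 < Om u v;
  rs_cont : forall u v, D u v ->
    cont2_at D r u v /\ cont2_at D Om u v /\ cont2_at D ru u v /\ cont2_at D rv u v /\
    cont2_at D phiu u v /\ cont2_at D phiv u v;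
  rs_r_u : forall u v, D u v -> pd_u r u v (ru u v);
  rs_r_v : forall u v, D u v -> pd_v r u v (rv u v);
  rs_ru_v : forall u v, D u v ->
    pd_v ru u v ((- ru u v * rv u v - / 4 * Om u v ^ 2) / r u v);
  rs_rv_u : forall u v, D u v ->
    pd_u rv u v ((- ru u v * rv u v - / 4 * Om u v ^ 2) / r u v);
  rs_phiu_v : forall u v, D u v ->
    pd_v phiu u v ((- ru u v * phiv u v - rv u v * phiu u v) / r u v);
  rs_phiv_u : forall u v, D u v ->
    pd_u phiv u v ((- ru u v * phiv u v - rv u v * phiu u v) / r u v);
  rs_raychaudhuri_u : forall u v, D u v ->
    pd_u (fun x y => ru x y / Om x y ^ 2) u v (- r u v / Om u v ^ 2 * phiu u v ^ 2);
  rs_raychaudhuri_v : forall u v, D u v ->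
    pd_v (fun x y => rv x y / Om x y ^ 2) u v (- r u v / Om u v ^ 2 * phiv u v ^ 2) }.

(** The system is invariant under exchanging the two null directions, so each estimate below is
    proved for one direction and transported to the other. *)
Lemma RegularSolution_swap D r Om ru rv phiu phiv :
  RegularSolution D r Om ru rv phiu phiv ->
  RegularSolution (fun x y => D y x) (fun x y => r y x) (fun x y => Om y x)
    (fun x y => rv y x) (fun x y => ru y x) (fun x y => phiv y x) (fun x y => phiu y x).
Proof.
  intros HS. split; intros u v Huv.
  - now apply (rs_r_pos _ _ _ _ _ _ _ HS).
  - now apply (rs_Om_pos _ _ _ _ _ _ _ HS).
  - destruct (rs_cont _ _ _ _ _ _ _ HS v u Huv) as (? & ? & ? & ? & ? & ?).
    repeat split; apply cont2_at_swap; assumption.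
  - exact (rs_r_v _ _ _ _ _ _ _ HS v u Huv).
  - exact (rs_r_u _ _ _ _ _ _ _ HS v u Huv).
  - replace (- rv v u * ru v u) with (- ru v u * rv v u) by ring.
    exact (rs_rv_u _ _ _ _ _ _ _ HS v u Huv).
  - replace (- rv v u * ru v u) with (- ru v u * rv v u) by ring.
    exact (rs_ru_v _ _ _ _ _ _ _ HS v u Huv).
  - replace (- rv v u * phiu v u - ru v u * phiv v u)
      with (- ru v u * phiv v u - rv v u * phiu v u) by ring.
    exact (rs_phiv_u _ _ _ _ _ _ _ HS v u Huv).
  - replace (- rv v u * phiu v u - ru v u * phiv v u)
      with (- ru v u * phiv v u - rv v u * phiu v u) by ring.
    exact (rs_phiu_v _ _ _ _ _ _ _ HS v u Huv).
  - exact (rs_raychaudhuri_v _ _ _ _ _ _ _ HS v u Huv).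
  - exact (rs_raychaudhuri_u _ _ _ _ _ _ _ HS v u Huv).
Qed.

(** By Raychaudhuri [rv / Om^2] does not increase in [v], so it stays negative and its modulus stays
    at least [1 / K]. The constant [K] is carried along for the later bound on [r * ru]. *)
Lemma trapped_propagates D r Om ru rv phiu phiv (u v0 v K : R) :
  RegularSolution D r Om ru rv phiu phiv ->
  v0 <= v -> (forall y, v0 <= y <= v -> D u y) ->
  rv u v0 < 0 -> Om u v0 ^ 2 <= K * - rv u v0 ->
  rv u v < 0 /\ Om u v ^ 2 <= K * - rv u v.
Proof.
  intros HS Hv HD Hneg HK.
  assert (Hmono : rv u v / Om u v ^ 2 <= rv u v0 / Om u v0 ^ 2).
  { apply (nonincreasing_of_derive_nonpos (fun y => rv u y / Om u y ^ 2)
             (fun y => - r u y / Om u y ^ 2 * phiv u y ^ 2)); [assumption|].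
    intros y Hy. split; [now apply (rs_raychaudhuri_v _ _ _ _ _ _ _ HS), HD|].
    pose proof (rs_r_pos _ _ _ _ _ _ _ HS u y (HD y Hy)) as Hr.
    pose proof (rs_Om_pos _ _ _ _ _ _ _ HS u y (HD y Hy)) as HOm.
    replace (- r u y / Om u y ^ 2 * phiv u y ^ 2)
      with (- (r u y * (phiv u y / Om u y) ^ 2)) by (field; lra).
    pose proof (pow2_ge_0 (phiv u y / Om u y)). nra. }
  assert (H0 : 0 < Om u v0 ^ 2) by (apply pow_lt, (rs_Om_pos _ _ _ _ _ _ _ HS), HD; lra).
  assert (H1 : 0 < Om u v ^ 2) by (apply pow_lt, (rs_Om_pos _ _ _ _ _ _ _ HS), HD; lra).
  (* In terms of the ratios the hypothesis reads [1 <= K * - q0], and [q <= q0] passes it on to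
     [q]. *)
  set (q0 := rv u v0 / Om u v0 ^ 2) in *. set (q := rv u v / Om u v ^ 2) in *.
  assert (Hq0 : rv u v0 = q0 * Om u v0 ^ 2) by (unfold q0; field; nra).
  assert (Hq : rv u v = q * Om u v ^ 2) by (unfold q; field; nra).
  assert (q0 < 0) by nra.
  assert (0 < K) by nra.
  assert (1 <= K * - q0) by nra.
  assert (1 <= K * - q) by nra.
  split; nra.
Qed.

(** The rectangle may stick out of [D] beyond the singular boundary: only its two initial edges must
    lie in [D], together with the past, within the rectangle, of each of its points in [D]. Each
    sign is prescribed on the edge from which Raychaudhuri carries it inwards. *)
Record TrappedBox (D : R -> R -> Prop) (ru rv : R -> R -> R) (u1 u2 v1 v2 : R) : Prop := {
  tb_u : u1 <= u2;
  tb_v : v1 <= v2;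
  tb_past : forall u v x y, D u v -> u1 <= x <= u -> u <= u2 -> v1 <= y <= v -> v <= v2 -> D x y;
  tb_bottom : forall x, u1 <= x <= u2 -> D x v1 /\ rv x v1 < 0;
  tb_left : forall y, v1 <= y <= v2 -> D u1 y /\ ru u1 y < 0 }.

Lemma TrappedBox_swap D ru rv u1 u2 v1 v2 :
  TrappedBox D ru rv u1 u2 v1 v2 ->
  TrappedBox (fun x y => D y x) (fun x y => rv y x) (fun x y => ru y x) v1 v2 u1 u2.
Proof.
  intros [H1 H2 H3 H4 H5]. split; try assumption.
  intros u v x y HD Hx Hu Hy Hv. now apply (H3 v u).
Qed.

Lemma TrappedBox_rv_neg D r Om ru rv phiu phiv u1 u2 v1 v2 :
  RegularSolution D r Om ru rv phiu phiv -> TrappedBox D ru rv u1 u2 v1 v2 ->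
  forall u v, u1 <= u <= u2 -> v1 <= v <= v2 -> D u v -> rv u v < 0.
Proof.
  intros HS HT u v Hu Hv HD.
  destruct (tb_bottom _ _ _ _ _ _ _ HT u Hu) as [_ Hb].
  (* Only the sign is wanted here, so [K] is the ratio at the starting point, which makes its
     hypothesis an equality. *)
  apply (trapped_propagates D r Om ru rv phiu phiv u v1 v (Om u v1 ^ 2 / - rv u v1) HS).
  - lra.
  - intros y Hy. apply (tb_past _ _ _ _ _ _ _ HT u v); (assumption || lra).
  - assumption.
  - apply Req_le. field. lra.
Qed.

Lemma TrappedBox_ru_neg D r Om ru rv phiu phiv u1 u2 v1 v2 :
  RegularSolution D r Om ru rv phiu phiv -> TrappedBox D ru rv u1 u2 v1 v2 ->
  forall u v, u1 <= u <= u2 -> v1 <= v <= v2 -> D u v -> ru u v < 0.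
Proof.
  intros HS HT u v Hu Hv HD.
  apply (TrappedBox_rv_neg _ _ _ _ _ _ _ _ _ _ _
           (RegularSolution_swap _ _ _ _ _ _ _ HS) (TrappedBox_swap _ _ _ _ _ _ _ HT) v u);
    assumption.
Qed.

Lemma bottom_edge_bound (D : R -> R -> Prop) (F : R -> R -> R) (u1 u2 v1 : R) :
  u1 <= u2 ->
  (forall x, u1 <= x <= u2 -> D x v1 /\ cont2_at D F x v1) ->
  exists C, 0 < C /\ forall x, u1 <= x <= u2 -> F x v1 <= C.
Proof.
  intros Hu HF.
  destruct (rectangle_max D F u1 u2 v1 v1) as [p [q [Hp [Hq H]]]]; [assumption|lra| |].
  { intros x y Hx Hy. replace y with v1 by lra. now apply HF. }
  exists (1 + Rabs (F p q)). pose proof (Rabs_pos (F p q)). pose proof (Rle_abs (F p q)).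
  split; [lra|]. intros x Hx. specialize (H x v1 Hx ltac:(lra)). lra.
Qed.

(* With [Om^2 <= K * - rv], the function [- r ru + K/4 r] has [v]-derivative
   [Om^2/4 + K/4 rv <= 0]. *)
Lemma r_ru_bounded D r Om ru rv phiu phiv u1 u2 v1 v2 :
  RegularSolution D r Om ru rv phiu phiv -> TrappedBox D ru rv u1 u2 v1 v2 ->
  exists B, 0 < B /\ forall u v, u1 <= u <= u2 -> v1 <= v <= v2 -> D u v ->
    - (r u v * ru u v) <= B.
Proof.
  intros HS HT.
  (* A single [K] for all [u], by compactness of the bottom edge; [trapped_propagates] then keeps it
     valid along every vertical line. *)
  destruct (bottom_edge_bound D (fun x y => Om x y ^ 2 / - rv x y) u1 u2 v1)
    as [K [HK0 HK]]; [apply HT| |].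
  { intros x Hx. destruct (tb_bottom _ _ _ _ _ _ _ HT x Hx) as [HD Hneg].
    destruct (rs_cont _ _ _ _ _ _ _ HS _ _ HD) as (? & ? & ? & ? & ? & ?).
    split; [assumption|]. apply cont2_at_div; [lra| |].
    - now apply cont2_at_pow.
    - now apply cont2_at_opp. }
  destruct (bottom_edge_bound D (fun x y => - (r x y * ru x y) + K / 4 * r x y) u1 u2 v1)
    as [B [HB0 HB]]; [apply HT| |].
  { intros x Hx. destruct (tb_bottom _ _ _ _ _ _ _ HT x Hx) as [HD _].
    destruct (rs_cont _ _ _ _ _ _ _ HS _ _ HD) as (? & ? & ? & ? & ? & ?).
    split; [assumption|]. apply cont2_at_plus.
    - now apply cont2_at_opp, cont2_at_mult.
    - apply cont2_at_mult; [apply cont2_at_const|assumption]. }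
  exists B. split; [assumption|]. intros u v Hu Hv HD.
  assert (Hseg : forall y, v1 <= y <= v -> D u y).
  { intros y Hy. apply (tb_past _ _ _ _ _ _ _ HT u v); (assumption || lra). }
  assert (Hmono : - (r u v * ru u v) + K / 4 * r u v
                  <= - (r u v1 * ru u v1) + K / 4 * r u v1).
  { apply (nonincreasing_of_derive_nonpos (fun y => - (r u y * ru u y) + K / 4 * r u y)
      (fun y => - (rv u y * ru u y
                   + r u y * ((- ru u y * rv u y - / 4 * Om u y ^ 2) / r u y))
                + K / 4 * rv u y)); [lra|].
    intros y Hy. specialize (Hseg y Hy) as HDy.
    pose proof (rs_r_v _ _ _ _ _ _ _ HS _ _ HDy) as Hrv.
    split.
    - apply derivable_pt_lim_plus; [apply derivable_pt_lim_opp, derivable_pt_lim_mult|].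
      + exact Hrv.
      + exact (rs_ru_v _ _ _ _ _ _ _ HS _ _ HDy).
      + apply derivable_pt_lim_scal. exact Hrv.
    - pose proof (rs_r_pos _ _ _ _ _ _ _ HS _ _ HDy).
      destruct (tb_bottom _ _ _ _ _ _ _ HT u Hu) as [_ Hneg].
      destruct (trapped_propagates D r Om ru rv phiu phiv u v1 y K HS) as [_ HKy].
      + lra.
      + intros z Hz. apply Hseg. lra.
      + assumption.
      + apply Rmult_le_reg_r with (/ - rv u v1); [apply Rinv_0_lt_compat; lra|].
        rewrite Rmult_assoc, Rinv_r, Rmult_1_r by lra. now apply HK.
      + replace (r u y * ((- ru u y * rv u y - / 4 * Om u y ^ 2) / r u y))
          with (- ru u y * rv u y - / 4 * Om u y ^ 2) by (field; lra). nra. }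
  specialize (HB u Hu). cbv beta in HB.
  pose proof (rs_r_pos _ _ _ _ _ _ _ HS _ _ HD). nra.
Qed.

(* Both terms of the [v]-derivative of [r phiu / ru] push its modulus down as long as it
   dominates the modulus of [r phiv / rv]; the second one does so strictly. *)
Lemma weighted_phiu_derive D r Om ru rv phiu phiv (u v : R) :
  RegularSolution D r Om ru rv phiu phiv -> D u v -> ru u v <> 0 -> rv u v <> 0 ->
  pd_v (fun x y => r x y * phiu x y / ru x y) u v
    (rv u v / r u v * (r u v * phiu u v / ru u v - r u v * phiv u v / rv u v)
     + Om u v ^ 2 / (4 * r u v * ru u v) * (r u v * phiu u v / ru u v)).
Proof.
  intros HS HD Hu Hv.
  pose proof (rs_r_pos _ _ _ _ _ _ _ HS _ _ HD) as Hr.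
  match goal with |- pd_v _ _ _ ?l => replace l with
    (((rv u v * phiu u v
       + r u v * ((- ru u v * phiv u v - rv u v * phiu u v) / r u v)) * ru u v
      - (- ru u v * rv u v - / 4 * Om u v ^ 2) / r u v * (r u v * phiu u v)) / Rsqr (ru u v))
    by (unfold Rsqr; field; repeat split; (assumption || lra)) end.
  apply (derivable_pt_lim_div (fun y => r u y * phiu u y) (fun y => ru u y)).
  - apply derivable_pt_lim_mult.
    + exact (rs_r_v _ _ _ _ _ _ _ HS _ _ HD).
    + exact (rs_phiu_v _ _ _ _ _ _ _ HS _ _ HD).
  - exact (rs_ru_v _ _ _ _ _ _ _ HS _ _ HD).
  - assumption.
Qed.

(** Write [W] and [Z] for the weighted derivatives of the field. At a maximum of [W^2] along the
    [v]-line its derivative is nonnegative, yet half of it equals [- al * (W^2 - Z * W) - k * W^2]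
    with [al] and [k] positive. As [Z^2 <= W^2] makes the first term nonpositive, [W] must
    vanish. *)
Lemma weighted_phiu_max_zero D r Om ru rv phiu phiv (u v v1 : R) :
  RegularSolution D r Om ru rv phiu phiv -> D u v -> ru u v < 0 -> rv u v < 0 ->
  v1 < v ->
  (forall y, v1 <= y <= v -> (r u y * phiu u y / ru u y) ^ 2 <= (r u v * phiu u v / ru u v) ^ 2) ->
  (r u v * phiv u v / rv u v) ^ 2 <= (r u v * phiu u v / ru u v) ^ 2 ->
  (r u v * phiu u v / ru u v) ^ 2 <= 0.
Proof.
  intros HS HD Hu Hv Hv1 Hmax HZW.
  pose proof (weighted_phiu_derive _ _ _ _ _ _ _ u v HS HD ltac:(lra) ltac:(lra)) as Hder.
  assert (Hder2 := derivable_pt_lim_mult _ _ _ _ _ Hder Hder).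
  apply (derive_left_max_nonneg _ v1) in Hder2; [|assumption|].
  - pose proof (rs_r_pos _ _ _ _ _ _ _ HS _ _ HD) as Hr.
    pose proof (rs_Om_pos _ _ _ _ _ _ _ HS _ _ HD) as HOm.
    set (W := r u v * phiu u v / ru u v) in *. set (Z := r u v * phiv u v / rv u v) in *.
    assert (Ha : 0 < - rv u v / r u v) by (apply Rdiv_lt_0_compat; lra).
    assert (Hk : 0 < Om u v ^ 2 / (4 * r u v * - ru u v)).
    { apply Rdiv_lt_0_compat; [now apply pow_lt|]. apply Rmult_lt_0_compat; lra. }
    set (al := - rv u v / r u v) in *. set (k := Om u v ^ 2 / (4 * r u v * - ru u v)) in *.
    replace (rv u v / r u v) with (- al) in Hder2 by (unfold al; field; lra).
    replace (Om u v ^ 2 / (4 * r u v * ru u v)) with (- k) in Hder2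
      by (unfold k; field; lra).
    (* From [2 * Z * W <= Z^2 + W^2 <= 2 * W^2]. *)
    assert (0 <= W ^ 2 - Z * W) by nra.
    assert (0 <= al * (W ^ 2 - Z * W)) by (apply Rmult_le_pos; lra).
    assert (k * W ^ 2 <= 0) by nra.
    nra.
  - intros y Hy. specialize (Hmax y Hy). unfold mult_fct. simpl in Hmax. nra.
Qed.

Lemma weighted_phi_maximum_principle D r Om ru rv phiu phiv u1 u2 v1 v2 M (u v : R) :
  RegularSolution D r Om ru rv phiu phiv -> TrappedBox D ru rv u1 u2 v1 v2 ->
  0 <= M ->
  (forall x, u1 <= x <= u2 -> (r x v1 * phiu x v1 / ru x v1) ^ 2 <= M) ->
  (forall y, v1 <= y <= v2 -> (r u1 y * phiv u1 y / rv u1 y) ^ 2 <= M) ->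
  u1 <= u <= u2 -> v1 <= v <= v2 -> D u v ->
  (r u v * phiu u v / ru u v) ^ 2 <= M /\ (r u v * phiv u v / rv u v) ^ 2 <= M.
Proof.
  intros HS HT HM HMb HMl Hu Hv HD.
  assert (Hrect : forall x y, u1 <= x <= u -> v1 <= y <= v -> D x y).
  { intros x y Hx Hy. apply (tb_past _ _ _ _ _ _ _ HT u v); (assumption || lra). }
  assert (Hneg : forall x y, u1 <= x <= u -> v1 <= y <= v -> ru x y < 0 /\ rv x y < 0).
  { intros x y Hx Hy. specialize (Hrect x y Hx Hy). split.
    - apply (TrappedBox_ru_neg _ _ _ _ _ _ _ _ _ _ _ HS HT); (assumption || lra).
    - apply (TrappedBox_rv_neg _ _ _ _ _ _ _ _ _ _ _ HS HT); (assumption || lra). }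
  set (W := fun x y => (r x y * phiu x y / ru x y) ^ 2).
  set (Z := fun x y => (r x y * phiv x y / rv x y) ^ 2).
  assert (Hcont : forall x y, u1 <= x <= u -> v1 <= y <= v ->
            D x y /\ cont2_at D W x y /\ cont2_at D Z x y).
  { intros x y Hx Hy. specialize (Hneg x y Hx Hy). specialize (Hrect x y Hx Hy).
    destruct (rs_cont _ _ _ _ _ _ _ HS _ _ Hrect) as (? & ? & ? & ? & ? & ?).
    split; [assumption|].
    split; apply cont2_at_pow, cont2_at_div; try (now apply cont2_at_mult); (assumption || lra). }
  destruct (rectangle_max D W u1 u v1 v) as [p [q [Hp [Hq HW]]]]; [lra|lra| |].
  { intros x y Hx Hy. split; apply Hcont; assumption. }
  destruct (rectangle_max D Z u1 u v1 v) as [p' [q' [Hp' [Hq' HZ]]]]; [lra|lra| |].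
  { intros x y Hx Hy. split; apply Hcont; assumption. }
  assert (W p q <= M /\ Z p' q' <= M).
  { destruct (Rle_dec (Z p' q') (W p q)) as [Hle|Hle].
    - assert (W p q <= M); [|lra].
      destruct (Req_dec q v1) as [->|Hne]; [apply HMb; lra|].
      apply Rle_trans with 0; [|assumption].
      apply (weighted_phiu_max_zero D r Om ru rv phiu phiv p q v1); try assumption.
      + now apply Hrect.
      + now apply Hneg.
      + now apply Hneg.
      + lra.
      + intros y Hy. apply HW; lra.
      + apply Rle_trans with (2 := Hle). now apply HZ.
    - assert (Z p' q' <= M); [|lra].
      destruct (Req_dec p' u1) as [->|Hne]; [apply HMl; lra|].
      apply Rle_trans with 0; [|assumption].
      apply (weighted_phiu_max_zero _ _ _ _ _ _ _ q' p' u1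
               (RegularSolution_swap _ _ _ _ _ _ _ HS)).
      + now apply Hrect.
      + now apply Hneg.
      + now apply Hneg.
      + lra.
      + intros x Hx. apply HZ; lra.
      + apply Rle_trans with (W p q); [now apply HW|unfold W, Z in *; lra]. }
  specialize (HW u v ltac:(lra) ltac:(lra)). specialize (HZ u v ltac:(lra) ltac:(lra)).
  unfold W, Z in *. lra.
Qed.

(** * From weighted bounds to inverse square bounds *)

Lemma weighted_phiu_bottom_bound D r Om ru rv phiu phiv u1 u2 v1 v2 :
  RegularSolution D r Om ru rv phiu phiv -> TrappedBox D ru rv u1 u2 v1 v2 ->
  exists M, 0 < M /\ forall x, u1 <= x <= u2 -> (r x v1 * phiu x v1 / ru x v1) ^ 2 <= M.
Proof.
  intros HS HT.
  apply (bottom_edge_bound D (fun x y => (r x y * phiu x y / ru x y) ^ 2)); [apply HT|].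
  intros x Hx. destruct (tb_bottom _ _ _ _ _ _ _ HT x Hx) as [HD _].
  assert (ru x v1 < 0).
  { apply (TrappedBox_ru_neg _ _ _ _ _ _ _ _ _ _ _ HS HT); try assumption.
    pose proof (tb_v _ _ _ _ _ _ _ HT). lra. }
  destruct (rs_cont _ _ _ _ _ _ _ HS _ _ HD) as (? & ? & ? & ? & ? & ?).
  split; [assumption|]. apply cont2_at_pow, cont2_at_div; [lra| |assumption].
  now apply cont2_at_mult.
Qed.

(** With [W = rr * f / g] one has [rr^2 * |f| = |W| * (- rr * g)]; the factor [1 + M] bounds [|W|]
    without a square root. *)
Lemma inverse_square_bound (rr f g M B : R) :
  0 < rr -> g < 0 -> - (rr * g) <= B -> (rr * f / g) ^ 2 <= M ->
  Rabs f <= (1 + M) * B / rr ^ 2.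
Proof.
  intros Hr Hg HB HM. set (W := rr * f / g) in *.
  assert (HW : Rabs W <= 1 + M) by (apply Rabs_le; nra).
  assert (Hr2 : 0 < rr ^ 2) by now apply pow_lt.
  apply Rmult_le_reg_r with (rr ^ 2); [assumption|].
  replace ((1 + M) * B / rr ^ 2 * rr ^ 2) with ((1 + M) * B) by (field; lra).
  replace f with (W * g / rr) by (unfold W; field; lra).
  replace (Rabs (W * g / rr) * rr ^ 2) with (Rabs W * - (rr * g)).
  - pose proof (Rabs_pos W). apply Rmult_le_compat; nra.
  - unfold Rdiv. rewrite !Rabs_mult, Rabs_inv, (Rabs_left g), (Rabs_pos_eq rr) by lra.
    field. lra.
Qed.

Lemma trapped_box_phi_bound D r Om ru rv phiu phiv u1 u2 v1 v2 :
  RegularSolution D r Om ru rv phiu phiv -> TrappedBox D ru rv u1 u2 v1 v2 ->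
  exists D1 D2, 0 < D1 /\ 0 < D2 /\
    forall u v, u1 <= u <= u2 -> v1 <= v <= v2 -> D u v ->
      Rabs (phiu u v) <= D1 / r u v ^ 2 /\ Rabs (phiv u v) <= D2 / r u v ^ 2.
Proof.
  intros HS HT.
  pose proof (RegularSolution_swap _ _ _ _ _ _ _ HS) as HS'.
  pose proof (TrappedBox_swap _ _ _ _ _ _ _ HT) as HT'.
  destruct (weighted_phiu_bottom_bound _ _ _ _ _ _ _ _ _ _ _ HS HT) as [M1 [HM1 Hb]].
  destruct (weighted_phiu_bottom_bound _ _ _ _ _ _ _ _ _ _ _ HS' HT') as [M2 [HM2 Hl]].
  destruct (r_ru_bounded _ _ _ _ _ _ _ _ _ _ _ HS HT) as [B1 [HB1 H1]].
  destruct (r_ru_bounded _ _ _ _ _ _ _ _ _ _ _ HS' HT') as [B2 [HB2 H2]].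
  cbv beta in *.
  (* The maximum principle couples both derivatives, so one constant has to dominate the data on
     both initial edges: [M1 + M2]. *)
  exists ((1 + (M1 + M2)) * B1), ((1 + (M1 + M2)) * B2).
  split; [nra|split; [nra|]]. intros u v Hu Hv HD.
  destruct (weighted_phi_maximum_principle _ _ _ _ _ _ _ _ _ _ _ (M1 + M2) u v HS HT)
    as [HW HZ]; try assumption.
  - lra.
  - intros x Hx. specialize (Hb x Hx). lra.
  - intros y Hy. specialize (Hl y Hy). lra.
  - split.
    + apply inverse_square_bound with (ru u v); try assumption.
      * now apply (rs_r_pos _ _ _ _ _ _ _ HS).
      * now apply (TrappedBox_ru_neg _ _ _ _ _ _ _ _ _ _ _ HS HT).
      * now apply H1.
    + apply inverse_square_bound with (rv u v); try assumption.
      * now apply (rs_r_pos _ _ _ _ _ _ _ HS).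
      * now apply (TrappedBox_rv_neg _ _ _ _ _ _ _ _ _ _ _ HS HT).
      * now apply H2.
Qed.

(** * Trapped rectangles near the singular boundary *)

Definition QInt (d : CharData) (Q : R -> R -> Prop) (u v : R) : Prop := Q u v /\ Int d u v.

Lemma QInt_open d Q s u v :
  IsDevelopment d Q s -> QInt d Q u v ->
  exists delta, 0 < delta /\
    forall x y, Rabs (x - u) < delta -> Rabs (y - v) < delta -> QInt d Q x y.
Proof.
  intros (_ & _ & _ & _ & _ & Hopen & _) [HQ (H1 & H2 & H3)].
  destruct (Hopen u v HQ) as [d0 [Hd0 H]].
  set (m := Rmin d0 (Rmin (u - cd_u0 d) (Rmin ((v - u) / 2) (v - cd_v1 d)))).
  assert (Hm : 0 < m /\ m <= d0 /\ m <= u - cd_u0 d /\ m <= (v - u) / 2 /\ m <= v - cd_v1 d).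
  { unfold m. split; [repeat apply Rmin_pos; lra|]. unfold Rmin.
    repeat destruct Rle_dec; lra. }
  exists m. split; [lra|]. intros x y Hx Hy.
  assert (HI : Int d x y).
  { apply Rabs_def2 in Hx, Hy. unfold Int. lra. }
  split; [|assumption]. apply H; [|lra|lra]. unfold Reg. unfold Int in HI. lra.
Qed.

Lemma QInt_past d Q s u v x y :
  IsDevelopment d Q s -> QInt d Q u v -> Int d x y -> x <= u -> y <= v -> QInt d Q x y.
Proof.
  intros (_ & _ & _ & _ & Hpast & _) [HQ _] HI Hx Hy. split; [|assumption].
  apply (Hpast u v); try assumption. unfold Reg. unfold Int in HI. lra.
Qed.

(** Dividing by [r > 0] solves the wave equations for the [v]-derivatives of [sru] and [sphiu]. The
    right sides are continuous, so [mixed_partials] supplies the [u]-derivatives of [srv] and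
    [sphiv] with the same values. *)
Lemma development_regular d Q s :
  IsDevelopment d Q s ->
  RegularSolution (QInt d Q) (sr s) (sOm s) (sru s) (srv s) (sphiu s) (sphiv s).
Proof.
  intros HDev. pose proof HDev as
    (_ & _ & _ & _ & _ & _ & HC0 & HC1 & Heq & HOm & Hr & _).
  assert (Hrpos : forall u v, QInt d Q u v -> 0 < sr s u v).
  { intros u v [HQ HI]. apply Hr; [assumption|apply HI]. }
  assert (Hcont : forall u v, QInt d Q u v ->
    cont2_at (QInt d Q) (sr s) u v /\ cont2_at (QInt d Q) (sOm s) u v /\
    cont2_at (QInt d Q) (sru s) u v /\ cont2_at (QInt d Q) (srv s) u v /\
    cont2_at (QInt d Q) (sphiu s) u v /\ cont2_at (QInt d Q) (sphiv s) u v).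
  { intros u v HD. destruct (HC0 u v (proj1 HD)) as (? & ? & _).
    destruct (HC1 u v HD) as (_ & _ & _ & _ & _ & _ & ? & ? & _ & _ & ? & ?).
    repeat split; try assumption; apply (cont2_at_subset Q); try assumption;
      intros x y Hxy; apply Hxy. }
  assert (Hruv : forall u v, QInt d Q u v ->
    pd_v (sru s) u v ((- sru s u v * srv s u v - / 4 * sOm s u v ^ 2) / sr s u v)).
  { intros u v HD. destruct (Heq u v HD) as ([a [Ha Hra]] & _).
    rewrite <- Hra. specialize (Hrpos u v HD).
    replace (sr s u v * a / sr s u v) with a by (field; lra). assumption. }
  assert (Hpuv : forall u v, QInt d Q u v ->
    pd_v (sphiu s) u v
      ((- sru s u v * sphiv s u v - srv s u v * sphiu s u v) / sr s u v)).
  { intros u v HD. destruct (Heq u v HD) as (_ & _ & [c [Hc Hrc]] & _).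
    rewrite <- Hrc. specialize (Hrpos u v HD).
    replace (sr s u v * c / sr s u v) with c by (field; lra). assumption. }
  split; try assumption.
  - intros u v HD. apply HOm, HD.
  - intros u v HD. apply (HC1 u v HD).
  - intros u v HD. apply (HC1 u v HD).
  - intros u v HD. apply (mixed_partials (QInt d Q) (sr s) (sru s) (srv s)
      (fun x y => (- sru s x y * srv s x y - / 4 * sOm s x y ^ 2) / sr s x y)).
    + now apply (QInt_open d Q s).
    + intros x y Hxy. pose proof (HC1 x y Hxy) as (? & ? & _). auto.
    + destruct (Hcont u v HD) as (? & ? & ? & ? & ? & ?). specialize (Hrpos u v HD).
      apply cont2_at_div; [lra| |assumption]. apply cont2_at_plus.
      * apply cont2_at_mult; [now apply cont2_at_opp|assumption].
      * apply cont2_at_opp, cont2_at_mult; [apply cont2_at_const|now apply cont2_at_pow].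
  - intros u v HD. apply (mixed_partials (QInt d Q) (sphi s) (sphiu s) (sphiv s)
      (fun x y => (- sru s x y * sphiv s x y - srv s x y * sphiu s x y) / sr s x y)).
    + now apply (QInt_open d Q s).
    + intros x y Hxy. pose proof (HC1 x y Hxy) as (_ & _ & _ & _ & ? & ? & _). auto.
    + destruct (Hcont u v HD) as (? & ? & ? & ? & ? & ?). specialize (Hrpos u v HD).
      apply cont2_at_div; [lra| |assumption]. apply cont2_at_plus.
      * apply cont2_at_mult; [now apply cont2_at_opp|assumption].
      * now apply cont2_at_opp, cont2_at_mult.
  - intros u v HD. apply (Heq u v HD).
  - intros u v HD. apply (Heq u v HD).
Qed.

(** A positive function tending to 0 at [b] falls below its midpoint value at some later point; the
    mean value theorem between the two gives a negative slope. *)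
Lemma negative_derive_before_zero (g g' : R -> R) (a b : R) :
  a < b ->
  (forall t, a < t < b -> derivable_pt_lim g t (g' t) /\ 0 < g t) ->
  (forall eps, 0 < eps -> exists t0, t0 < b /\ forall t, t0 < t < b -> g t < eps) ->
  exists t, a < t < b /\ g' t < 0.
Proof.
  intros Hab Hg Hlim.
  set (m := (a + b) / 2).
  destruct (Hlim (g m)) as [t0 [Ht0 H]]; [apply Hg; unfold m; lra|].
  set (t1 := (Rmax m t0 + b) / 2).
  assert (Ht1 : m < t1 < b /\ t0 < t1).
  { pose proof (Rmax_l m t0). pose proof (Rmax_r m t0).
    assert (Rmax m t0 < b) by (apply Rmax_lub_lt; unfold m; lra).
    unfold t1. lra. }
  destruct (MVT_cor2 g g' m t1) as [c [Hc1 Hc2]]; [lra| |].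
  { intros t Ht. apply Hg. unfold m in *. lra. }
  exists c. split; [unfold m in *; lra|].
  specialize (H t1 ltac:(lra)). nra.
Qed.

Lemma QInt_negative_nearby d Q s (f : R -> R -> R) u v :
  IsDevelopment d Q s -> QInt d Q u v -> cont2_at (QInt d Q) f u v -> f u v < 0 ->
  exists delta, 0 < delta /\
    forall x y, Rabs (x - u) < delta -> Rabs (y - v) < delta -> QInt d Q x y /\ f x y < 0.
Proof.
  intros HDev HD Hc Hneg.
  destruct (QInt_open d Q s u v HDev HD) as [d1 [Hd1 H1]].
  destruct (Hc (- f u v)) as [d2 [Hd2 H2]]; [lra|].
  exists (Rmin d1 d2). split; [now apply Rmin_pos|]. intros x y Hx Hy.
  pose proof (Rmin_l d1 d2). pose proof (Rmin_r d1 d2).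
  assert (HDxy : QInt d Q x y) by (apply H1; lra).
  split; [assumption|].
  specialize (H2 x y HDxy ltac:(lra) ltac:(lra)). apply Rabs_def2 in H2. lra.
Qed.

(** Adherence to [Q] gives the weak inequalities. Equality is impossible on the initial cones, which
    lie in [Q], and at the centre, since points just below the boundary curve at the same [u] would
    belong to [Q] with [v < u]. *)
Lemma FutBdry_interior d Q s b u v :
  IsDevelopment d Q s -> SingularBoundary d Q s b -> FutBdry Q u v -> (u, v) <> (b, b) ->
  Int d u v.
Proof.
  intros HDev HB HF Hne.
  destruct HDev as (H01 & HReg & Hout & Hin & _).
  destruct HB as (_ & _ & _ & Hcurve).
  destruct (Hcurve u v HF Hne) as (dl & beta & beta' & Hdl & Hbeta & _ & HQ).
  destruct HF as [HnQ Hadh].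
  assert (Hclosed : forall eps, 0 < eps ->
            cd_u0 d < u + eps /\ u < v + eps /\ cd_v1 d < v + eps).
  { intros eps Heps. destruct (Hadh (eps / 2)) as [x [y [Hxy [Hx Hy]]]]; [lra|].
    apply HReg in Hxy. apply Rabs_def2 in Hx, Hy. unfold Reg in Hxy. lra. }
  assert (Hle : cd_u0 d <= u /\ u <= v /\ cd_v1 d <= v).
  { repeat split; apply le_epsilon; intros eps Heps; specialize (Hclosed eps Heps); lra. }
  assert (Hu : u <> cd_u0 d) by (intros ->; now apply HnQ, Hout).
  assert (Hv : v <> cd_v1 d) by (intros ->; apply HnQ, Hin; lra).
  assert (Huv : u <> v).
  { intros Heq. assert (Q u (v - dl / 2)) as Hin'.
    { apply HQ; [rewrite Rminus_diag, Rabs_R0; lra| |lra].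
      apply Rabs_def1; lra. }
    apply HReg in Hin'. unfold Reg in Hin'. lra. }
  unfold Int. lra.
Qed.

(* [r] tends to 0 along both null lines running into [(u, v)], so [rv] and [ru] are negative
   somewhere on each of them; this spreads to nearby parallel lines and, by Raychaudhuri, to
   their whole future. *)
Lemma TrappedBox_near_boundary d Q s b u v :
  IsDevelopment d Q s -> SingularBoundary d Q s b -> FutBdry Q u v -> (u, v) <> (b, b) ->
  exists u1 u2 v1 v2, u1 < u < u2 /\ v1 < v < v2 /\
    TrappedBox (QInt d Q) (sru s) (srv s) u1 u2 v1 v2.
Proof.
  intros HDev HB HF Hne.
  destruct (FutBdry_interior d Q s b u v HDev HB HF Hne) as (Hu0 & Huv & Hv1).
  pose proof (development_regular d Q s HDev) as HS.
  destruct HB as (_ & _ & Hr0 & Hcurve).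
  destruct (Hcurve u v HF Hne) as (dl & beta & beta' & Hdl & Hbeta & Hdbeta & HQ).
  (* The bound [(v - u) / 2] gives [u + m <= v - m], which keeps the box away from the centre. *)
  set (m := Rmin dl (Rmin (u - cd_u0 d) (Rmin ((v - u) / 2) (v - cd_v1 d)))).
  assert (Hm : 0 < m /\ m <= dl /\ m <= u - cd_u0 d /\ m <= (v - u) / 2 /\ m <= v - cd_v1 d).
  { unfold m. split; [repeat apply Rmin_pos; lra|]. unfold Rmin.
    repeat destruct Rle_dec; lra. }
  clearbody m.
  assert (Hline_v : forall y, v - m < y < v -> QInt d Q u y).
  { intros y Hy. split; [|unfold Int; lra].
    apply HQ; [rewrite Rminus_diag, Rabs_R0; lra|apply Rabs_def1; lra|lra]. }
  assert (Hline_u : forall x, u - m < x < u -> QInt d Q x v).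
  { intros x Hx. split; [|unfold Int; lra].
    apply HQ; [apply Rabs_def1; lra|rewrite Rminus_diag, Rabs_R0; lra|].
    (* Here the boundary being spacelike enters: [beta] decreases, so [beta x > v] for [x < u] and
       the line reaches the boundary point from within [Q]. *)
    destruct (MVT_cor2 beta beta' x u) as [c [Hc1 Hc2]]; [lra| |].
    - intros c Hc. apply Hdbeta. apply Rabs_def1; lra.
    - assert (beta' c < 0) by (apply Hdbeta; apply Rabs_def1; lra). nra. }
  assert (Hlim : forall eps, 0 < eps -> exists e, 0 < e /\
            forall x y, QInt d Q x y -> Rabs (x - u) < e -> Rabs (y - v) < e -> sr s x y < eps).
  { intros eps Heps. destruct (Hr0 u v HF eps Heps) as [e [He H]]. exists e.
    split; [assumption|]. intros x y [Hxy _] Hx Hy.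
    apply Rle_lt_trans with (1 := Rle_abs _). now apply H. }
  destruct (negative_derive_before_zero (fun y => sr s u y) (fun y => srv s u y) (v - m) v)
    as [vs [Hvs Hnegv]]; [lra| | |].
  { intros y Hy. specialize (Hline_v y Hy). split.
    - exact (rs_r_v _ _ _ _ _ _ _ HS _ _ Hline_v).
    - exact (rs_r_pos _ _ _ _ _ _ _ HS _ _ Hline_v). }
  { intros eps Heps. destruct (Hlim eps Heps) as [e [He H]].
    exists (Rmax (v - m) (v - e)). pose proof (Rmax_l (v - m) (v - e)).
    pose proof (Rmax_r (v - m) (v - e)).
    split; [apply Rmax_lub_lt; lra|]. intros y Hy. apply H.
    - apply Hline_v. lra.
    - rewrite Rminus_diag, Rabs_R0. assumption.
    - apply Rabs_def1; lra. }
  destruct (negative_derive_before_zero (fun x => sr s x v) (fun x => sru s x v) (u - m) u)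
    as [us [Hus Hnegu]]; [lra| | |].
  { intros x Hx. specialize (Hline_u x Hx). split.
    - exact (rs_r_u _ _ _ _ _ _ _ HS _ _ Hline_u).
    - exact (rs_r_pos _ _ _ _ _ _ _ HS _ _ Hline_u). }
  { intros eps Heps. destruct (Hlim eps Heps) as [e [He H]].
    exists (Rmax (u - m) (u - e)). pose proof (Rmax_l (u - m) (u - e)).
    pose proof (Rmax_r (u - m) (u - e)).
    split; [apply Rmax_lub_lt; lra|]. intros x Hx. apply H.
    - apply Hline_u. lra.
    - apply Rabs_def1; lra.
    - rewrite Rminus_diag, Rabs_R0. assumption. }
  destruct (QInt_negative_nearby d Q s (srv s) u vs HDev (Hline_v vs Hvs)) as [ev [Hev Hnv]];
    [apply (rs_cont _ _ _ _ _ _ _ HS), Hline_v, Hvs|assumption|].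
  destruct (QInt_negative_nearby d Q s (sru s) us v HDev (Hline_u us Hus)) as [eu [Heu Hnu]];
    [apply (rs_cont _ _ _ _ _ _ _ HS), Hline_u, Hus|assumption|].
  (* Closeness to [u] puts every line starting on the bottom edge in the range where [srv] is
     negative at height [vs]; [vs <= v1] lets that sign propagate up to the edge. The left edge is
     treated likewise from [us]. *)
  assert (Hpick : exists u1 v1, us <= u1 < u /\ u - ev < u1 /\ vs <= v1 < v /\ v - eu < v1).
  { exists (Rmax us (u - ev / 2)), (Rmax vs (v - eu / 2)).
    pose proof (Rmax_l us (u - ev / 2)). pose proof (Rmax_r us (u - ev / 2)).
    pose proof (Rmax_l vs (v - eu / 2)). pose proof (Rmax_r vs (v - eu / 2)).
    assert (Rmax us (u - ev / 2) < u) by (apply Rmax_lub_lt; lra).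
    assert (Rmax vs (v - eu / 2) < v) by (apply Rmax_lub_lt; lra). lra. }
  destruct Hpick as (u1 & v1 & Hu1 & Hu1' & Hv1' & Hv1'').
  destruct (QInt_open d Q s u v1 HDev (Hline_v v1 ltac:(lra))) as [e1 [He1 Ho1]].
  destruct (QInt_open d Q s u1 v HDev (Hline_u u1 ltac:(lra))) as [e2 [He2 Ho2]].
  (* The box has to extend beyond the boundary point: [e1] and [e2] keep the far ends of the two
     initial edges in the domain, [ev] and [eu] keep the signs there. *)
  assert (Hpick : exists e, 0 < e /\ e < m /\ e < e1 /\ e < e2 /\ e < ev /\ e < eu).
  { exists (Rmin m (Rmin e1 (Rmin e2 (Rmin ev eu))) / 2).
    assert (0 < Rmin m (Rmin e1 (Rmin e2 (Rmin ev eu)))) by (repeat apply Rmin_pos; lra).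
    set (k := Rmin _ _) in *.
    assert (k <= m /\ k <= e1 /\ k <= e2 /\ k <= ev /\ k <= eu); [|lra].
    unfold k, Rmin. repeat destruct Rle_dec; lra. }
  destruct Hpick as (e & He & Hem & Hee1 & Hee2 & Heev & Heeu).
  assert (Hcorner_u : QInt d Q (u + e) v1).
  { apply Ho1; [|rewrite Rminus_diag, Rabs_R0; assumption].
    replace (u + e - u) with e by ring. rewrite Rabs_pos_eq; lra. }
  assert (Hcorner_v : QInt d Q u1 (v + e)).
  { apply Ho2; [rewrite Rminus_diag, Rabs_R0; assumption|].
    replace (v + e - v) with e by ring. rewrite Rabs_pos_eq; lra. }
  exists u1, (u + e), v1, (v + e). split; [lra|]. split; [lra|].
  split; [lra|lra| | |].
  - intros x y x' y' HD Hx Hxu Hy Hyv. apply (QInt_past d Q s x y); try assumption; try lra.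
    unfold Int. lra.
  - intros x Hx.
    assert (Hx' : forall y, vs <= y <= v1 -> QInt d Q x y).
    { intros y Hy. apply (QInt_past d Q s (u + e) v1); try assumption; try lra.
      unfold Int. lra. }
    split; [apply Hx'; lra|].
    assert (Hn : srv s x vs < 0).
    { apply Hnv; [apply Rabs_def1; lra|rewrite Rminus_diag, Rabs_R0; assumption]. }
    apply (trapped_propagates _ _ _ _ _ _ _ x vs v1 (sOm s x vs ^ 2 / - srv s x vs) HS);
      try assumption; [lra|]. apply Req_le. field. lra.
  - intros y Hy.
    assert (Hy' : forall x, us <= x <= u1 -> QInt d Q x y).
    { intros x Hx. apply (QInt_past d Q s u1 (v + e)); try assumption; try lra.
      unfold Int. lra. }
    split; [apply Hy'; lra|].
    assert (Hn : sru s us y < 0).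
    { apply Hnu; [rewrite Rminus_diag, Rabs_R0; assumption|apply Rabs_def1; lra]. }
    apply (trapped_propagates _ _ _ _ _ _ _ y us u1 (sOm s us y ^ 2 / - sru s us y)
             (RegularSolution_swap _ _ _ _ _ _ _ HS));
      try assumption; [lra|]. apply Req_le. field. lra.
Qed.

Theorem theorem1p2 (d : CharData) (Q : R -> R -> Prop) (s : Sol) (b : R)
  (Hmax : IsMaxDevelopment d Q s)
  (Htrap : exists u v, Trapped d Q s u v)
  (HB : SingularBoundary d Q s b)
  (uP vP : R) (HP : FutBdry Q uP vP) (HPB0 : (uP, vP) <> (b, b)) :
  exists delta D1 D2, 0 < delta /\ 0 < D1 /\ 0 < D2 /\
    forall u v, Trapped d Q s u v ->
      Rabs (u - uP) < delta -> Rabs (v - vP) < delta ->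
      Rabs (sphiu s u v) <= D1 / sr s u v ^ 2 /\
      Rabs (sphiv s u v) <= D2 / sr s u v ^ 2.
Proof.
  destruct Hmax as [HDev _].
  destruct (TrappedBox_near_boundary d Q s b uP vP HDev HB HP HPB0)
    as (u1 & u2 & v1 & v2 & Hu & Hv & HT).
  destruct (trapped_box_phi_bound _ _ _ _ _ _ _ _ _ _ _ (development_regular d Q s HDev) HT)
    as (D1 & D2 & HD1 & HD2 & Hbound).
  (* The distance from the boundary point to the sides of the box, so that the square neighbourhood
     fits inside. *)
  set (m := Rmin (Rmin (uP - u1) (u2 - uP)) (Rmin (vP - v1) (v2 - vP))).
  assert (Hm : 0 < m /\ m <= uP - u1 /\ m <= u2 - uP /\ m <= vP - v1 /\ m <= v2 - vP).
  { unfold m. split; [repeat apply Rmin_pos; lra|]. unfold Rmin.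
    repeat destruct Rle_dec; lra. }
  exists m, D1, D2. split; [lra|]. split; [assumption|]. split; [assumption|].
  intros u v (HQ & HI & _) Hdu Hdv. apply Rabs_def2 in Hdu, Hdv.
  apply Hbound; [lra|lra|now split].
Qed.
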